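(* Let $M\in\mathbb{N}$ be even, $M\ge2$, and $n=M/2$. For every real $\chi>-1$ the extended Gramian closure $\mathcal{C}:\mathcal{R}\to\mathbb{R}$ for even $M$, $$u_{2n+1}=\mathcal{C}(u_0,\dots,u_{2n})=u_{n+1,2n}^{T}G_{n-1}^{-1}u_{n,2n-1}+\chi\,\frac{\sigma_{n,n}}{\sigma_{n-1,n-1}}\,\sigma_{n-1,n},$$ is strictly hyperbolic.
   Context: Realizable moments: $\mathcal{R}\subset\mathbb{R}^{M+1}$ is the set of vectors $(u_0,\dots,u_M)$ with $u_k=\int_{\mathbb{R}}c^kf(c)\,dc$ for some measurable $f:\mathbb{R}\to[0,\infty)$, not almost everywhere zero, with finite moments up to order $M$. This is an open subset of $\mathbb{R}^{M+1}$. Gramian matrix: $G_k=(u_{i+j})_{i,j=0,\dots,k}\in\mathbb{R}^{(k+1)\times(k+1)}$; it is symmetric positive definite for $2k\le M$ and realizable moments. For $k\le l$, $u_{k,l}=(u_k,u_{k+1},\dots,u_l)^T$. Terms involving the empty matrix $G_{-1}$ are zero. For $k\ge0$, $$\sigma_{k,k}=u_{2k}-u_{k,2k-1}^TG_{k-1}^{-1}u_{k,2k-1},\qquad \sigma_{k,k+1}=u_{2k+1}-u_{k+1,2k}^TG_{k-1}^{-1}u_{k,2k-1}.$$ Characteristic polynomial of a closure $u_{M+1}=\mathcal{C}(u_0,\dots,u_M)$: $\mathcal{P}_{M+1}(z)=z^{M+1}-\sum_{j=0}^{M}\frac{\partial\mathcal{C}}{\partial u_j}(u_0,\dots,u_M)\,z^j$.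 Strict hyperbolicity: $\mathcal{C}$ is strictly hyperbolic if $\mathcal{P}_{M+1}$ has $M+1$ distinct real roots for all $(u_0,\dots,u_M)\in\mathcal{R}$. *)

(* Defs.v *)
From mathcomp Require Export all_boot all_order all_algebra.
From mathcomp Require Export all_classical all_reals all_analysis.

Set Implicit Arguments.
Unset Strict Implicit.
Unset Printing Implicit Defensive.

Import Order.TTheory GRing.Theory Num.Theory.
Import numFieldNormedType.Exports.

Local Open Scope classical_set_scope.
Local Open Scope ring_scope.

(* u_k; [inord] is only meaningful for k <= M, the only case used below. *)
Definition moment (R : realType) (M : nat) (u : 'rV[R]_M.+1) (k : nat) : R :=
  u 0 (inord k).

Definition realizable (R : realType) (M : nat) : set 'rV[R]_M.+1 :=
  [set u | exists f : R -> R,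
    [/\ measurable_fun setT f,
        forall c, 0 <= f c,
        ~ {ae @lebesgue_measure R, forall c, f c = 0} &
        forall k, (k <= M)%N ->
          (@lebesgue_measure R).-integrable setT
            (fun c => (c ^+ k * f c)%:E) /\
          moment u k = \int[@lebesgue_measure R]_c (c ^+ k * f c)]].

(* Indexed by its size: G_k is [gramian u k.+1] and G_{k-1} is [gramian u k].
   For k = 0 the latter is the 0 x 0 matrix, so every quadratic term in its
   inverse is an empty sum, i.e. zero. *)
Definition gramian (R : realType) (M : nat) (u : 'rV[R]_M.+1) (k : nat) :
    'M[R]_k :=
  \matrix_(i < k, j < k) moment u (i + j).

(* u_{k,l} with l = k + d - 1, given by its first index and its length d. *)
Definition moments_from (R : realType) (M : nat) (u : 'rV[R]_M.+1)
    (k d : nat) : 'cV[R]_d :=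
  \col_(i < d) moment u (k + i).

(* (u_{a,a+k-1})^T G_{k-1}^{-1} u_{b,b+k-1} *)
Definition gramian_form (R : realType) (M : nat) (u : 'rV[R]_M.+1)
    (k a b : nat) : R :=
  ((moments_from u a k)^T *m invmx (gramian u k) *m moments_from u b k) 0 0.

(* sigma_{k,k} *)
Definition sigma_diag (R : realType) (M : nat) (u : 'rV[R]_M.+1) (k : nat) :
    R :=
  moment u k.*2 - gramian_form u k k k.

(* sigma_{k,k+1} *)
Definition sigma_next (R : realType) (M : nat) (u : 'rV[R]_M.+1) (k : nat) :
    R :=
  moment u k.*2.+1 - gramian_form u k k.+1 k.

(* A closure is represented by a total function on R^{M+1}; only its values
   on the open set of realizable moments matter. *)
Definition extended_gramian_closure (R : realType) (M : nat) (chi : R)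
    (u : 'rV[R]_M.+1) : R :=
  let n := M./2 in
  gramian_form u n n.+1 n +
    chi * (sigma_diag u n / sigma_diag u n.-1) * sigma_next u n.-1.

Definition closure_char_poly (R : realType) (M : nat) (C : 'rV[R]_M.+1 -> R)
    (u : 'rV[R]_M.+1) : {poly R} :=
  'X^(M.+1) - \sum_(j < M.+1) ('D_(delta_mx 0 j) C u) *: 'X^j.

(* The first conjunct makes the partial derivatives in the characteristic
   polynomial meaningful, since 'D_v is total. *)
Definition strictly_hyperbolic (R : realType) (M : nat)
    (C : 'rV[R]_M.+1 -> R) : Prop :=
  forall u, realizable u ->
    (forall j : 'I_M.+1, derivable C u (delta_mx 0 j)) /\
    exists zs : seq R,
      [/\ uniq zs, size zs = M.+1 & all (root (closure_char_poly C u)) zs].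

(* Main.v *)
From HB Require Import structures.
Require Import Defs.
From mathcomp Require Import polyrcf ring lra zify.
Import Order.TTheory GRing.Theory Num.Theory.
Import numFieldNormedType.Exports.
Local Open Scope ring_scope.

Set Implicit Arguments.
Unset Strict Implicit.
Unset Printing Implicit Defensive.

(* Let L be the functional with L(X^i) = u_i; it is positive on squares, so it
   has monic orthogonal polynomials Q_k = X^k - proj_{<k} X^k. More generally
   let R_{k,b} be the residual of X^b modulo degree < k. If the functional is
   moved in the direction of evaluation at z, the form
   u_{a,..}^T G_{k-1}^{-1} u_{b,..} has derivative
   z^(a+b) - R_{k,a}(z) R_{k,b}(z), which yields sigma_{k,k}' = Q_k^2 and
   sigma_{k,k+1}' = R_{k,k+1} Q_k. With a = sigma_{n-1,n} / sigma_{n-1,n-1} and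
   beta = sigma_{n,n} / sigma_{n-1,n-1}, one has R_{n-1,n} = Q_n + a Q_{n-1} and
   R_{n,n+1} = (X + a) Q_n - beta Q_{n-1}, and the characteristic polynomial
   factors as
     Q_n ((X - (chi - 1) a) Q_n - (1 + chi) beta Q_{n-1}).
   As (1 + chi) beta > 0, the second factor is one more step of a three-term
   recurrence of Favard type, so its n + 1 roots are real, simple and
   interlace the n roots of Q_n. *)

(** * Real roots and three-term recurrences *)

Section RealRoots.
Variable R : rcfType.
Implicit Types (p q r : {poly R}) (s t : seq R).

Local Notation prodX s := (\prod_(x <- s) ('X - x%:P)).

Lemma horner_prodX_deriv s1 x s2 :
  (prodX (s1 ++ x :: s2))^`().[x] = \prod_(y <- s1 ++ s2) (x - y).
Proof.
have -> : prodX (s1 ++ x :: s2) = ('X - x%:P) * prodX (s1 ++ s2).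
  by rewrite !big_cat big_cons /= mulrCA.
rewrite derivM !hornerE derivXsubC hornerC subrr mul0r addr0 mul1r.
by rewrite horner_prod; apply: eq_bigr => y _; rewrite !hornerE.
Qed.

(** No [z] of either list lies between [x] and [y], so [x - z] and [y - z] have the same sign. *)
Lemma prod_sub_same_sign x y s1 s2 :
  x < y -> all (< x) s1 -> all (> y) s2 ->
  0 < \prod_(z <- s1 ++ s2) (x - z) * \prod_(z <- s1 ++ s2) (y - z).
Proof.
move=> xy s1x ys2; rewrite -big_split big_seq; apply: prodr_gt0 => z.
rewrite mem_cat => /orP[/(allP s1x)|/(allP ys2)] /= ?; nra.
Qed.

(** The two derivatives contain the factors [x - y] and [y - x], of negative product; the other
    factors agree in sign because [x] and [y] are neighbours. *)
Lemma sorted_deriv_alternate s : sorted <%R s ->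
  forall s1 x y s2, s = s1 ++ x :: y :: s2 ->
  (prodX s)^`().[x] * (prodX s)^`().[y] < 0.
Proof.
move=> ss s1 x y s2 es.
rewrite {1}es horner_prodX_deriv es -(cat1s x) catA horner_prodX_deriv.
move: ss; rewrite es sorted_pairwise; last exact: lt_trans.
rewrite pairwise_cat /= => /and4P[/allrelP s1lt _ /andP[xy xs2] /andP[ys2 _]].
have := @prod_sub_same_sign x y s1 s2 xy.
rewrite ys2 (_ : all (< x) s1); last first.
  by apply/allP => z zs; apply: s1lt; rewrite ?mem_head.
move=> /(_ isT isT).
rewrite !big_cat !big_cons big_nil /= => h.
have d : 0 < (y - x) ^+ 2 by rewrite exprn_gt0 // subr_gt0.
rewrite -oppr_gt0; apply: lt_le_trans (mulr_gt0 d h) _.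
by rewrite le_eqVlt; apply/orP; left; apply/eqP; ring.
Qed.

(** The intermediate value theorem gives a root in each open gap; the gaps are disjoint and ordered,
    so the roots increase strictly. *)
Lemma roots_of_sign_changes r x s :
  path (fun a b => (a < b) && (r.[a] * r.[b] < 0)) x s ->
  exists t, [/\ size t = size s, path <%R x t & all (root r) t].
Proof.
elim: s x => [|y s IH] x /=; first by exists [::].
move=> /andP[/andP[xy sgn]] /IH[t [<- pt rt]].
have [z] := poly_ivtoo (ltW xy) sgn; rewrite in_itv /= => /andP[xz zy] rz.
exists (z :: t); split=> //=; last by rewrite rz.
rewrite xz; case: t pt {rt} => //= w t /andP[yw ->].
by rewrite (lt_trans zy yw).
Qed.

(** The derivative of the product alternates in sign along its simple roots, so a polynomial sharing
    its signs there changes sign on every gap. *)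
Lemma interlacing_roots r x s : sorted <%R (x :: s) ->
  (forall y, y \in x :: s -> 0 < r.[y] * (prodX (x :: s))^`().[y]) ->
  exists t, [/\ size t = size s, uniq t & all (root r) t].
Proof.
move=> ss rs.
suff /roots_of_sign_changes[t [st pt rt]] :
    path (fun a b => (a < b) && (r.[a] * r.[b] < 0)) x s.
  by exists t; split=> //; exact/(sorted_uniq lt_trans ltxx)/(path_sorted pt).
(* The induction runs over suffixes of the list, so that the derivative of the full product stays
   fixed. *)
have : forall s1 y s2, x :: s = s1 ++ y :: s2 ->
    path (fun a b => (a < b) && (r.[a] * r.[b] < 0)) y s2.
  move=> s1 y s2; elim: s2 s1 y => // z s2 IH s1 y es /=.
  rewrite (IH (rcons s1 y)) ?cat_rcons // andbT.
  have yz : y < z.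
    by move: ss; rewrite es sorted_cat_cons /= => /andP[_ /andP[]].
  rewrite yz /=.
  have := sorted_deriv_alternate ss es.
  have := rs y; have := rs z.
  rewrite es !mem_cat !inE !eqxx !orbT => /(_ isT) rz /(_ isT) ry yz0.
  rewrite -(nmulr_lgt0 _ yz0) mulrACA; exact: mulr_gt0.
by move=> /(_ [::] x s erefl).
Qed.

(** Even size means odd degree, so the negative of [p \Po - 'X] is again monic, and its behaviour at
    plus infinity controls [p] at minus infinity. *)
Lemma monic_odd_sign_bound p : p \is monic -> ~~ odd (size p) ->
  exists B, forall x, B <= x -> 0 < p.[x] /\ p.[- x] < 0.
Proof.
move=> pm evp.
have [|B1 hB1] := @poly_pinfty_gt_lc _ p; first by rewrite (monicP pm).
have lN : lead_coef (- (p \Po - 'X)) = 1.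
  rewrite lead_coefN lead_coef_comp ?size_polyN ?size_polyX //.
  rewrite lead_coefN lead_coefX (monicP pm) mul1r -signr_odd.
  have p0 : (0 < size p)%N by rewrite size_poly_gt0 monic_neq0.
  by move: evp; rewrite -{1}(prednK p0) /= negbK => ->; rewrite expr1 opprK.
have [|B2 hB2] := @poly_pinfty_gt_lc _ (- (p \Po - 'X)); first by rewrite lN.
exists (Num.max B1 B2) => x; rewrite ge_max => /andP[/hB1 h1 /hB2 h2].
move: h1; rewrite (monicP pm) => /(lt_le_trans ltr01) h1; split=> //.
move: h2; rewrite lN hornerN horner_comp hornerN hornerX.
by move=> /(lt_le_trans ltr01); rewrite oppr_gt0.
Qed.

(* The Wronskian condition makes q alternate in sign on consecutive roots of p,
   and propagates along the recurrence: W(r, p) = p^2 + b W(p, q) for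
   r = (X - a) p - b q. *)
Definition interlacing_pair p q :=
  [/\ p \is monic,
      exists s, [/\ uniq s, size s = (size p).-1 & all (root p) s],
      (size q < size p)%N &
      forall x, 0 < p^`().[x] * q.[x] - p.[x] * q^`().[x]].

Lemma size_three_term p q a b : p \is monic -> (size q <= size p)%N ->
  size (('X - a%:P) * p - b *: q) = (size p).+1.
Proof.
move=> pm qp; have szX : size (('X - a%:P) * p) = (size p).+1.
  by rewrite size_monicM ?monicXsubC ?monic_neq0 // size_XsubC.
rewrite size_polyDl szX // size_polyN (leq_ltn_trans (size_scale_leq _ _)) //.
Qed.

Lemma monic_three_term p q a b : p \is monic -> (size q <= size p)%N ->
  ('X - a%:P) * p - b *: q \is monic.
Proof.
move=> pm qp; have szX : size (('X - a%:P) * p) = (size p).+1.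
  by rewrite size_monicM ?monicXsubC ?monic_neq0 // size_XsubC.
rewrite monicE lead_coefDl ?szX -?monicE ?monicMl ?monicXsubC //.
by rewrite size_polyN (leq_ltn_trans (size_scale_leq _ _)).
Qed.

(** At a root of [p] the new polynomial equals [- b q], and by the Wronskian condition [q] has the
    sign of the derivative of [p]; hence the new polynomial alternates along the roots of [p]. *)
Lemma interlacing_pair_step p q a b : 0 < b -> interlacing_pair p q ->
  interlacing_pair (('X - a%:P) * p - b *: q) p.
Proof.
move=> b0 [pm [s [us ss rs]] qp W]; set r := _ - _.
have p0 : p != 0 by rewrite monic_neq0.
have szp : (0 < size p)%N by rewrite size_poly_gt0.
have szr : size r = (size p).+1 by rewrite size_three_term // ltnW.
have rm : r \is monic by rewrite monic_three_term // ltnW.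
split=> //; last 2 first.
- by rewrite szr.
- move=> x; rewrite /r derivB derivM derivZ derivXsubC !hornerE.
  rewrite [ltRHS](_ : _ =
    p.[x] ^+ 2 + b * (p^`().[x] * q.[x] - p.[x] * q^`().[x])); last by ring.
  by rewrite ltr_wpDl ?sqr_ge0 // mulr_gt0.
rewrite szr /=.
have ep : p = prodX s.
  rewrite [LHS](@all_roots_prod_XsubC _ p s) ?(monicP pm) ?scale1r //.
    by rewrite ss prednK.
  by rewrite uniq_rootsE.
(* The product has odd degree, so far out [r] and [p] agree in sign on the right and differ on the
   left. *)
have [|//|B hB] := @monic_odd_sign_bound (r * p).
- by rewrite monicMl.
- by rewrite size_monicM // szr addSn /= oddD addbb.
(* Adding far away points - B' and B' to the roots of p reduces the existence of
   the two outer roots of r to that of roots between consecutive points. *)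
set B' := Num.max B 0 + \sum_(x <- s) `|x| + 1.
have sum_ge0 : 0 <= \sum_(x <- s) `|x| by apply: sumr_ge0.
have m0 : 0 <= Num.max B 0 by rewrite le_max lexx orbT.
have mB : B <= Num.max B 0 by rewrite le_max lexx.
have {}/hB[rpB rpNB] : B <= B' by rewrite /B'; lra.
have B'0 : 0 < B' by rewrite /B'; lra.
have sB x : x \in s -> - B' < x < B'.
  move=> xs; rewrite -ltr_norml /B' (big_rem x) //=.
  have : 0 <= \sum_(y <- rem x s) `|y| by apply: sumr_ge0.
  lra.
pose s' := sort <=%R s.
have es' : prodX s' = p by rewrite ep; apply: perm_big; rewrite perm_sort.
have [||t [st ut rt]] := @interlacing_roots r (- B') (rcons s' B'); last first.
- by exists t; split=> //; rewrite st size_rcons size_sort ss prednK.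
- rewrite big_cons -cats1 big_cat big_seq1 es' => y.
  (* At [- B'] and [B'] only the first term survives. At a root of [p] only the second does, and its
     negative factor compensates the sign of [- b q]. *)
  have -> : (('X - (- B')%:P) * (p * ('X - B'%:P)))^`().[y] =
      2 * y * p.[y] + (y ^+ 2 - B' ^+ 2) * p^`().[y].
    by rewrite !derivM !derivXsubC !hornerE; ring.
  rewrite inE mem_cat inE => /or3P[/eqP ->|ys|/eqP ->].
  + rewrite hornerM in rpNB; nra.
  + rewrite mem_sort in ys; have := sB _ ys => /andP[y1 y2].
    have /rootP py := allP rs _ ys.
    have := W y; rewrite /r !hornerE py => Wy.
    have yy : 0 < B' ^+ 2 - y ^+ 2 by rewrite subr_sqr mulr_gt0 //; lra.
    have := mulr_gt0 (mulr_gt0 b0 yy) Wy.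
    by rewrite [X in _ -> _ < X](_ : _ = (b * (B' ^+ 2 - y ^+ 2)) *
      (p^`().[y] * q.[y] - 0 * q^`().[y])) //; ring.
  + rewrite hornerM in rpB; nra.
- have : sorted <%R s' by rewrite sort_lt_sorted.
  rewrite -cats1 !sorted_pairwise; try exact: lt_trans.
  rewrite /= pairwise_cat all_cat /= => ->; rewrite allrel1r !andbT.
  rewrite (_ : - B' < B' = true); last by lra.
  rewrite andbT /=; apply/andP; split; apply/allP => x.
  + by rewrite mem_sort => /sB /andP[].
  + by rewrite mem_sort => /sB /andP[].
Qed.

End RealRoots.

(** * Orthogonal polynomials of a moment vector *)

Lemma rVpolyE (R : nzRingType) k (v : 'rV[R]_k) :
  rVpoly v = \sum_(i < k) v 0 i *: 'X^i.
Proof.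
apply/polyP=> j; rewrite coef_rVpoly coef_sum; case: insubP => [i _ ij|jk].
  rewrite (bigD1 i) //= big1 => [|l li]; rewrite coefZ coefXn -ij.
    by rewrite eqxx mulr1 addr0.
  by rewrite eq_sym (inj_eq val_inj) (negbTE li) mulr0.
rewrite big1 // => i _; rewrite coefZ coefXn gtn_eqF ?mulr0 //.
by rewrite (leq_trans (ltn_ord i)) // leqNgt.
Qed.

Section OrthogonalPolynomials.
Variables (R : realType) (M : nat) (u : 'rV[R]_M.+1).
Implicit Types (p q : {poly R}) (k a b i j : nat).

(** Beyond index [M], [moment] falls back to the entry of index 0. Linearity is unaffected, but
    values are meaningful only for size at most [M.+1]. *)
Definition moment_functional p : R := \sum_(i < size p) p`_i * moment u i.

Lemma moment_functional_widen p N : (size p <= N)%N ->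
  moment_functional p = \sum_(i < N) p`_i * moment u i.
Proof.
move=> pN; rewrite /moment_functional.
rewrite (big_ord_widen _ (fun i => p`_i * moment u i) pN).
rewrite big_mkcond; apply: eq_bigr => i _; case: ltnP => // /(nth_default 0) ->.
by rewrite mul0r.
Qed.

Lemma moment_functional_is_linear : linear_for *%R moment_functional.
Proof.
move=> c p q; set N := maxn (size p) (size q).
have pN : (size p <= N)%N by rewrite leq_maxl.
have qN : (size q <= N)%N by rewrite leq_maxr.
rewrite (moment_functional_widen pN) (moment_functional_widen qN).
rewrite (@moment_functional_widen (c *: p + q) N); last first.
  rewrite (leq_trans (size_polyD _ _)) // geq_max qN andbT.
  exact: leq_trans (size_scale_leq _ _) pN.
rewrite mulr_sumr -big_split; apply: eq_bigr => i _ /=.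
by rewrite coefD coefZ mulrDl mulrA.
Qed.

HB.instance Definition _ := GRing.isLinear.Build R {poly R} R *%R
  moment_functional moment_functional_is_linear.

Local Notation L := moment_functional.

Lemma moment_functionalXn k : L 'X^k = moment u k.
Proof.
rewrite /moment_functional size_polyXn big_ord_recr /= big1 ?add0r.
  by rewrite coefXn eqxx mul1r.
by move=> i _; rewrite coefXn ltn_eqF ?mul0r.
Qed.

Definition gramian_solution k b : 'cV[R]_k :=
  invmx (gramian u k) *m moments_from u b k.

(** For an invertible Gramian this is the orthogonal projection of ['X^b] onto degree below [k]: its
    coefficients solve the normal equations. *)
Definition projXn k b : {poly R} := rVpoly (gramian_solution k b)^T.

Definition residual k b : {poly R} := 'X^b - projXn k b.

Local Notation Q k := (residual k k).

Lemma size_projXn k b : (size (projXn k b) <= k)%N.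
Proof. exact: size_poly. Qed.

Lemma projXnE k b : projXn k b = \sum_(i < k) gramian_solution k b i 0 *: 'X^i.
Proof.
by rewrite /projXn rVpolyE; apply: eq_bigr => i _; rewrite mxE.
Qed.

(** Bridge from the matrix forms of the closure to polynomial algebra under [L]. *)
Lemma moment_functional_Xn_projXn a k b :
  L ('X^a * projXn k b) = gramian_form u k a b.
Proof.
rewrite projXnE mulr_sumr linear_sum /= /gramian_form -mulmxA mxE.
apply: eq_bigr => i _; rewrite -scalerAr linearZ /= -exprD moment_functionalXn.
by rewrite !mxE mulrC.
Qed.

Lemma moment_functional_Xn_residual a k b :
  L ('X^a * residual k b) = moment u (a + b) - gramian_form u k a b.
Proof.
rewrite mulrBr linearB /= moment_functional_Xn_projXn -exprD.
by rewrite moment_functionalXn.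
Qed.

Lemma residual_monic k b : (k <= b)%N -> residual k b \is monic.
Proof.
move=> kb; rewrite monicE lead_coefDl ?lead_coefXn //.
by rewrite size_polyN size_polyXn ltnS (leq_trans (size_projXn _ _)).
Qed.

Lemma size_residual k b : (k <= b)%N -> size (residual k b) = b.+1.
Proof.
move=> kb; rewrite size_polyDl size_polyXn //.
by rewrite size_polyN ltnS (leq_trans (size_projXn _ _)).
Qed.

Lemma sigma_diagE k : sigma_diag u k = L ('X^k * Q k).
Proof. by rewrite moment_functional_Xn_residual addnn. Qed.

Lemma sigma_nextE k : sigma_next u k = L ('X^(k.+1) * Q k).
Proof. by rewrite moment_functional_Xn_residual addSn addnn. Qed.

(** These are the normal equations. Only invertibility is assumed, so that the result also applies
    to perturbed moment vectors. *)
Lemma residual_orthogonal_unit k b p :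
  gramian u k \in unitmx -> (size p <= k)%N ->
  L (p * residual k b) = 0.
Proof.
move=> ku pk; rewrite -[p]coefK poly_def mulr_suml linear_sum big1 // => i _.
rewrite -scalerAl linearZ /= moment_functional_Xn_residual.
have ik : (i < k)%N by rewrite (leq_trans (ltn_ord i)).
rewrite (_ : gramian_form _ _ _ _ = moment u (i + b)) ?subrr ?mulr0 //.
transitivity ((gramian u k *m gramian_solution k b) (Ordinal ik) 0).
  rewrite /gramian_form -mulmxA mxE [RHS]mxE; apply: eq_bigr => j _.
  by rewrite !mxE.
by rewrite /gramian_solution mulKVmx // mxE addnC.
Qed.

(** * Consequences of positivity on squares *)

Variable n : nat.
Hypothesis L_pos : forall p, p != 0 -> (size p <= n.+1)%N -> 0 < L (p * p).

(** A kernel vector, read as a polynomial, would have a square on which [L] vanishes. *)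
Lemma gramian_unit k : (k <= n.+1)%N -> gramian u k \in unitmx.
Proof.
move=> kn; rewrite -row_free_unit -kermx_eq0; apply/rowV0P => v /sub_kermxP vG.
apply/eqP; apply/negPn/negP => v0.
have p0 : rVpoly v != 0.
  by apply: contraNneq v0 => p0; rewrite -(rVpolyK v) p0 linear0.
have := L_pos p0 (leq_trans (size_poly _ _) kn).
suff -> : L (rVpoly v * rVpoly v) = (v *m gramian u k *m v^T) 0 0.
  by rewrite vG mul0mx mxE ltxx.
have ev := rVpolyE v.
rewrite mxE {2}ev mulr_sumr linear_sum; apply: eq_bigr => j _.
rewrite -scalerAr linearZ /= mulrC !mxE; congr (_ * _).
rewrite ev mulr_suml linear_sum; apply: eq_bigr => i _.
by rewrite -scalerAl linearZ /= -exprD moment_functionalXn mxE.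
Qed.

Lemma residual_orthogonal k b p : (k <= n.+1)%N -> (size p <= k)%N ->
  L (p * residual k b) = 0.
Proof. by move=> /gramian_unit; exact: residual_orthogonal_unit. Qed.

Lemma orthogonal_eq0 p : (size p <= n.+1)%N ->
  (forall i, (i < size p)%N -> L ('X^i * p) = 0) -> p = 0.
Proof.
move=> pn h; apply/eqP/negPn/negP => /L_pos/(_ pn).
rewrite -{1}[p]coefK poly_def mulr_suml linear_sum big1 ?ltxx // => i _.
by rewrite -scalerAl linearZ /= h ?mulr0.
Qed.

(** The projection part of [Q k] is orthogonal to [Q k], so the value is [L (Q k * Q k)]. *)
Lemma sigma_diag_gt0 k : (k <= n)%N -> 0 < sigma_diag u k.
Proof.
move=> kn; rewrite sigma_diagE.
have -> : L ('X^k * Q k) = L (Q k * Q k).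
  rewrite {2}/residual mulrBl linearB /=.
  rewrite (@residual_orthogonal _ _ (projXn k k)) ?subr0 //.
    exact: leqW.
  exact: size_projXn.
by rewrite L_pos ?monic_neq0 ?residual_monic // size_residual.
Qed.

(** Both sides equal [L (residual k k.+1 * Q k)], since projections are orthogonal to residuals. *)
Lemma sigma_next_sym k : (k <= n)%N ->
  L ('X^k * residual k k.+1) = sigma_next u k.
Proof.
move=> kn; rewrite sigma_nextE.
have eqL a b : L ('X^a * residual k b) = L (residual k b * residual k a).
  rewrite [residual k a]/residual [X in _ = L X]mulrBr linearB /=.
  rewrite [residual k b * projXn _ _]mulrC.
  rewrite (@residual_orthogonal _ _ (projXn k a)) ?size_projXn ?(leqW kn) //.
  by rewrite subr0 mulrC.
by rewrite !eqL mulrC.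
Qed.

(* The sum of the first k + 1 diagonal recurrence coefficients. *)
Definition alpha_sum k : R := sigma_next u k / sigma_diag u k.

(** The difference of the two sides has degree at most [k] and is orthogonal to all of that degree:
    to lower powers automatically, to ['X^k] by the choice of [alpha_sum]. *)
Lemma residual_succ k : (k < n)%N ->
  residual k k.+1 = Q k.+1 + alpha_sum k *: Q k.
Proof.
move=> kn; apply/eqP; rewrite -subr_eq0; apply/eqP.
have sz : (size (residual k k.+1 - (Q k.+1 + alpha_sum k *: Q k))%R <= k.+1)%N.
  rewrite /residual opprD addrA opprB [_ - _ + _]addrC addrA addrNK.
  rewrite (leq_trans (size_polyD _ _)) // geq_max size_polyN.
  rewrite (leq_trans (size_scale_leq _ _)) ?size_residual // andbT.
  rewrite (leq_trans (size_polyD _ _)) // geq_max size_polyN size_projXn /=.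
  by rewrite (leq_trans (size_projXn _ _)).
apply: orthogonal_eq0; first by rewrite (leq_trans sz) // ltnW.
move=> i /leq_trans/(_ sz); rewrite ltnS => ik.
rewrite mulrBr [X in L (_ - X)]mulrDr linearB linearD /= -scalerAr linearZ /=.
rewrite (@residual_orthogonal k.+1) ?size_polyXn //; last by rewrite ltnS ltnW.
move: ik; rewrite leq_eqVlt => /orP[/eqP ->|ik].
  rewrite sigma_next_sym ?(ltnW kn) // -sigma_diagE /alpha_sum add0r.
  by rewrite divfK ?subrr // gt_eqF // sigma_diag_gt0 // ltnW.
rewrite !residual_orthogonal ?size_polyXn ?mulr0 ?addr0 ?subr0 //.
all: by rewrite leqW // ltnW.
Qed.

(** Again the difference is orthogonal to its own degree range; the shift by [alpha_sum k] removes
    the coefficient of ['X^(k.+1)]. *)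
Lemma residual_recurrence k : (k < n)%N ->
  residual k.+1 k.+2 = ('X + (alpha_sum k)%:P) * Q k.+1
                       - (sigma_diag u k.+1 / sigma_diag u k) *: Q k.
Proof.
move=> kn; have kn1 : (k <= n)%N := ltnW kn; have kn2 := leqW kn1.
have kn3 : (k < n.+1)%N by [].
apply/eqP; rewrite -subr_eq0; apply/eqP.
set d := _ - _.
(* Coefficients of ['X^k] are compared: [residual k k.+1] has none, and [Q k] is monic. *)
have cQ : (Q k.+1)`_k = - alpha_sum k.
  have := residual_succ kn => /(congr1 (fun p : {poly R} => p`_k)).
  rewrite coefD coefZ {1 3}/residual !coefB !coefXn !eqxx ltn_eqF // add0r.
  rewrite !(nth_default 0 (size_projXn _ _)) subr0 oppr0 mulr1 => e.
  by apply/eqP; rewrite -addr_eq0 -e.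
have sz : (size d <= k.+1)%N.
  have -> : d = 'X * projXn k.+1 k.+1
      + alpha_sum k *: (projXn k.+1 k.+1 - 'X^(k.+1))
      + (sigma_diag u k.+1 / sigma_diag u k) *: Q k - projXn k.+1 k.+2.
    rewrite /d /residual -!mul_polyC !exprS; ring.
  have : (size (Q k) <= k.+1)%N by rewrite size_residual.
  move: (Q k) => q sq; apply/leq_sizeP => j kj.
  rewrite !(coefD, coefN, coefZ, coefXM, coefXn).
  have -> : (j == 0)%N = false by case: j kj.
  rewrite (nth_default 0 (leq_trans (size_projXn _ _) kj)).
  rewrite (nth_default 0 (leq_trans (size_projXn _ _) kj)).
  rewrite (nth_default 0 (leq_trans sq kj)) mulr0 addr0 add0r oppr0 addr0.
  move: kj; rewrite leq_eqVlt => /orP[/eqP <-|kj].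
    move: cQ; rewrite /residual coefB coefXn ltn_eqF // eqxx /= sub0r.
    move=> /oppr_inj ->.
    by rewrite mulrN mulr1 subrr.
  rewrite nth_default; last first.
    by rewrite (leq_trans (size_projXn _ _)) // -ltnS prednK //; case: (j) kj.
  by rewrite gtn_eqF // oppr0 mulr0 addr0.
apply: orthogonal_eq0; first by rewrite (leq_trans sz) // ltnW.
move=> i /leq_trans/(_ sz) ik.
rewrite /d mulrBr linearB /= residual_orthogonal ?size_polyXn //.
rewrite sub0r.
apply/eqP; rewrite oppr_eq0; apply/eqP.
rewrite [X in L X]mulrBr linearB /= mulrDl [X in L X - _]mulrDr linearD /=.
rewrite mulrA -exprSr mul_polyC.
rewrite -!scalerAr !linearZ /= (@residual_orthogonal _ _ 'X^i) ?size_polyXn //.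
rewrite mulr0 addr0.
(* At [i = k] the ratio of the two [sigma_diag] makes the remaining terms cancel; below [k] each
   vanishes. *)
move: ik; rewrite ltnS leq_eqVlt => /orP[/eqP ->|ik].
  rewrite -!sigma_diagE scalerN.
  rewrite [_ *: _](@divfK _ (sigma_diag u k)) ?subrr // gt_eqF //.
  by rewrite sigma_diag_gt0 // ltnW.
rewrite !residual_orthogonal ?size_polyXn //.
by rewrite oppr0 scaler0 addr0.
Qed.

End OrthogonalPolynomials.

(** * Directional derivatives of the Gramian forms *)

Section DirectionalDerivatives.
Local Open Scope classical_set_scope.
Variables (R : realType) (M : nat).
Implicit Types (u : 'rV[R]_M.+1) (p q : {poly R}) (k a b : nat).

Lemma is_derive_cvg (V : normedModType R) (f : V -> R) x v (df : R) :
  h^-1 * (f (h *: v + x) - f x) @[h --> (0 : R)^'] --> df -> is_derive x v f df.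
Proof.
move=> h; apply: DeriveDef; first by apply: cvgP; exact: h.
by apply: cvg_lim; [|exact: h].
Qed.

(** * Linear systems along an affine pencil of matrices *)

Section AffinePencil.
Variables (k : nat) (G E : 'M[R]_k).
Hypothesis Gu : G \in unitmx.

(** Taking polynomials in the parameter as entries makes determinants and adjugates polynomial,
    hence continuous. *)
Let pencil : 'M[{poly R}]_k := map_mx polyC G + 'X *: map_mx polyC E.

Let pencilE h : G + h *: E = map_mx (horner_eval h) pencil.
Proof. by apply/matrixP => i j; rewrite !mxE /horner_eval !hornerE mulrC. Qed.

Let det_cvg : \det (G + h *: E) @[h --> (0 : R)] --> \det G.
Proof.
under eq_fun do rewrite pencilE det_map_mx /horner_eval.
have -> : \det G = (\det pencil).[0].
  by rewrite -[RHS]/(horner_eval _ _) -det_map_mx -pencilE scale0r addr0.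
exact: continuous_horner.
Qed.

Lemma near_pencil_unit : \forall h \near (0 : R), G + h *: E \in unitmx.
Proof.
have : \det G != 0 by rewrite -unitfE -unitmxE.
move=> /(cvgr_neq0 _ det_cvg); apply: filterS => h.
by rewrite unitmxE unitfE.
Qed.

(** By Cramer's rule the solution is a quotient of polynomials in [h] whose denominator is nonzero
    at 0. *)
Lemma cvg_pencil_solution (b c : 'cV[R]_k) i :
  (invmx (G + h *: E) *m (b + h *: c)) i 0 @[h --> (0 : R)] -->
  (invmx G *m b) i 0.
Proof.
pose rhs : 'cV[{poly R}]_k := map_mx polyC b + 'X *: map_mx polyC c.
have rhsE h : b + h *: c = map_mx (horner_eval h) rhs.
  by apply/matrixP => l j; rewrite !mxE /horner_eval !hornerE mulrC.
pose num := ((\adj pencil) *m rhs) i 0.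
have numE h : (\adj (G + h *: E) *m (b + h *: c)) i 0 = num.[h].
  by rewrite pencilE rhsE -map_mx_adj -map_mxM mxE.
have invE (A : 'M[R]_k) (y : 'cV[R]_k) : A \in unitmx ->
    (invmx A *m y) i 0 = (\det A)^-1 * (\adj A *m y) i 0.
  by rewrite /invmx => ->; rewrite -scalemxAl mxE.
have : (\det (G + h *: E))^-1 * num.[h] @[h --> (0 : R)] -->
    (\det G)^-1 * num.[0].
  apply: cvgM; last exact: continuous_horner.
  by apply: cvgV => //; rewrite -unitfE -unitmxE.
rewrite invE // -[in X in _ --> X -> _](numE 0) !scale0r !addr0.
apply: cvg_trans; apply: near_eq_cvg.
(* On a singular matrix [invmx] returns its argument, so the quotient formula is available only near
   0. *)
near=> h; rewrite invE ?numE //.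
by near: h; exact: near_pencil_unit.
Unshelve. all: by end_near. Qed.

End AffinePencil.

Variables (u : 'rV[R]_M.+1) (j : 'I_M.+1).
Local Notation e := (delta_mx 0 j : 'rV[R]_M.+1).

Lemma moment_line h k : (k <= M)%N ->
  moment (h *: e + u) k = moment u k + h * (k == j)%:R.
Proof.
move=> kM; rewrite /moment !mxE /= addrC; congr (_ + _ * _%:R).
by rewrite -val_eqE /= inordK.
Qed.

(** Partial derivatives thus become coefficient extraction: a gradient is stored as one polynomial
    whose [j]-th coefficient is the derivative in [u_j]. *)
Lemma moment_functional_line h p : (size p <= M.+1)%N ->
  moment_functional (h *: e + u) p = moment_functional u p + h * p`_j.
Proof.
move=> pM; rewrite !(moment_functional_widen _ pM).
under eq_bigr => i _ do rewrite moment_line -1?ltnS // mulrDr.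
rewrite big_split /=; congr (_ + _).
rewrite (bigD1 j) //= eqxx mulr1 mulrC big1 ?addr0 // => i ij.
by rewrite (negbTE (ij : i != j :> nat)) !mulr0.
Qed.

Lemma is_derive_moment k : (k <= M)%N ->
  is_derive u e (fun v => moment v k) ('X^k : {poly R})`_j.
Proof.
move=> kM; apply: is_derive_cvg; rewrite coefXn eq_sym.
set df : R := _%:R.
have : (fun=> df) h @[h --> (0 : R)^'] --> df by exact: cvg_cst.
apply: cvg_trans; apply: near_eq_cvg; near=> h.
rewrite moment_line // [_ + _ * _]addrC addrK mulKf //.
by near: h; exact: nbhs_dnbhs_neq.
Unshelve. all: by end_near. Qed.

(** * Gradient of a Gramian form whose moments all have index at most [M] *)

Section GramianForm.
Variables (k a b : nat).
Hypothesis ku : gramian u k \in unitmx.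
Hypothesis kM : (k.*2 <= M.+2)%N.
Hypothesis akM : (a + k <= M.+1)%N.
Hypothesis bkM : (b + k <= M.+1)%N.

Let E : 'M[R]_k := \matrix_(i < k, l < k) (i + l == j)%N%:R.
Let c : 'cV[R]_k := \col_(i < k) (b + i == j)%N%:R.

Let gramian_line h : gramian (h *: e + u) k = gramian u k + h *: E.
Proof.
apply/matrixP => i l; rewrite !mxE moment_line //.
by have := ltn_ord i; have := ltn_ord l; lia.
Qed.

Let near_unit : \forall h \near (0 : R), gramian (h *: e + u) k \in unitmx.
Proof.
by have := near_pencil_unit E ku; apply: filterS => h; rewrite gramian_line.
Qed.

Lemma cvg_coef_projXn i :
  (projXn (h *: e + u) k b)`_i @[h --> (0 : R)] --> (projXn u k b)`_i.
Proof.
rewrite coef_rVpoly; under eq_fun do rewrite coef_rVpoly.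
case: insubP => [l _ _|_]; last exact: cvg_cst.
rewrite mxE; under eq_fun do rewrite mxE.
rewrite /gramian_solution; under eq_fun do rewrite gramian_line.
have from_line h : moments_from (h *: e + u) b k = moments_from u b k + h *: c.
  apply/matrixP => r s; rewrite !mxE moment_line //.
  by have := ltn_ord r; lia.
by under eq_fun do rewrite from_line; exact: cvg_pencil_solution.
Qed.

(** Let [Y] project ['X^a] under [u] and [Z] project ['X^b] under the perturbed vector. The
    difference quotient is exactly the [j]-th coefficient of [('X^a - Y) * Z + Y * 'X^b], and [Z]
    tends to the unperturbed projection. *)
Lemma is_derive_gramian_form :
  is_derive u e (fun v => gramian_form v k a b)
    ('X^(a + b) - residual u k a * residual u k b)`_j.
Proof.
apply: is_derive_cvg.
have -> : 'X^(a + b) - residual u k a * residual u k b =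
    residual u k a * projXn u k b + projXn u k a * 'X^b.
  by rewrite /residual exprD; ring.
rewrite coefD.
have : (residual u k a * projXn (h *: e + u) k b)`_j + (projXn u k a * 'X^b)`_j
    @[h --> (0 : R)^'] -->
    (residual u k a * projXn u k b)`_j + (projXn u k a * 'X^b)`_j.
  apply: cvgD; last exact: cvg_cst.
  rewrite coefM; under eq_fun do rewrite coefM.
  apply: cvg_big => [|i _]; first exact: add_continuous.
  apply: cvgM; first exact: cvg_cst.
  by apply: cvg_within_filter; exact: cvg_coef_projXn.
apply: cvg_trans; apply: near_eq_cvg; near=> h.
have h0 : h != 0 by near: h; exact: nbhs_dnbhs_neq.
have hu : gramian (h *: e + u) k \in unitmx.
  by near: h; apply: nbhs_dnbhs; exact: near_unit.
set v := h *: e + u.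
have orth w p i : gramian w k \in unitmx -> (size p <= k)%N ->
    moment_functional w (p * projXn w k i) = moment_functional w (p * 'X^i).
  move=> wu pk; apply/eqP; rewrite eq_sym -subr_eq0 -linearB /= -mulrBr.
  by rewrite residual_orthogonal_unit.
have sY := size_projXn u k a; have sZ := size_projXn v k b.
have szM (p q : {poly R}) : (size p + size q <= M.+2)%N ->
    (size (p * q)%R <= M.+1)%N.
  by move=> pq; rewrite (leq_trans (size_polyMleq _ _)) //; case: (_ + _)%N pq.
set Y := projXn u k a in sY *; set Z := projXn v k b in sZ *.
(* Orthogonality under both functionals turns the difference of the two forms
   into an exact multiple of h, so that only the continuity of Z in h is needed
   and the inverse matrix is never differentiated. *)
have e1 : moment_functional u ('X^a * Z) = moment_functional u (Y * Z).
  by rewrite [Y * Z]mulrC orth // mulrC.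
have e2 : moment_functional v (Y * Z) = moment_functional v (Y * 'X^b).
  by rewrite orth.
have fu : gramian_form u k a b = moment_functional u (Y * 'X^b).
  rewrite -moment_functional_Xn_projXn -orth // mulrC -orth ?size_projXn //.
  by rewrite mulrC.
have fv : gramian_form v k a b = moment_functional v ('X^a * Z).
  by rewrite moment_functional_Xn_projXn.
move: e2 fv; rewrite !moment_functional_line;
  try by apply: szM; rewrite ?size_polyXn; lia.
move=> e2 fv; apply: (mulfI h0); rewrite mulVKf // fu fv e1.
rewrite {1}/residual -/Y mulrBl coefB.
move: e2; set y1 := moment_functional u _; set y2 := moment_functional u _.
set z1 := _`_j; set z2 := _`_j; set z3 := _`_j => e2.
have -> : y1 = y2 + h * z2 - h * z1 by rewrite -e2 addrK.
by rewrite [RHS]addrC !addrA addNr add0r mulrDr mulrBr [LHS]addrC addrA addrAC.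
Unshelve. all: by end_near. Qed.

End GramianForm.

End DirectionalDerivatives.

(** * Positivity for realizable moments *)

Section Realizability.
Variables (R : realType).
Local Notation mu := (@lebesgue_measure R).

Lemma ae_not_root (p : {poly R}) : p != 0 -> {ae mu, forall c, p.[c] != 0}.
Proof.
move=> p0; exists [set` rootsR p]%classic; split.
- apply: countable_measurable; last exact/finite_set_countable/finite_seq.
  by move=> c; exact: measurable_set1.
- by apply: countable_lebesgue_measure0; apply/finite_set_countable/finite_seq.
- move=> c /= /negP; rewrite negbK => pc.
  by rewrite -(roots_on_rootsR p0) in_itv /= rootE.
Qed.

Lemma moment_functional_integral M (u : 'rV[R]_M.+1) (f : R -> R)
    (p : {poly R}) :
  (forall k, (k <= M)%N -> mu.-integrable setT (fun c => (c ^+ k * f c)%:E) /\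
      moment u k = \int[mu]_c (c ^+ k * f c)) ->
  (size p <= M.+1)%N ->
  mu.-integrable setT (fun c => (p.[c] * f c)%:E) /\
  moment_functional u p = \int[mu]_c (p.[c] * f c).
Proof.
move=> hf pM.
have hE c : p.[c] * f c = \sum_(i < size p) p`_i * (c ^+ i * f c).
  by rewrite horner_coef mulr_suml; apply: eq_bigr => i _; rewrite mulrA.
under eq_fun do rewrite hE; under eq_Rintegral do rewrite hE.
(* The coefficients of [p] stay fixed while the number of summed terms varies. *)
rewrite /moment_functional; move: (size p) pM => N.
elim: N => [|N IH] NM.
  split; last first.
    by rewrite big_ord0 /Rintegral integral0_eq // => c _; rewrite big_ord0.
  by under eq_fun do rewrite big_ord0; exact: integrable0.
have [iN eN] := IH (ltnW NM); have [iX eX] := hf N NM.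
have iX' : mu.-integrable setT (fun c => (p`_N * (c ^+ N * f c))%:E).
  by under eq_fun do rewrite EFinM; exact: integrableZl.
split.
  by under eq_fun do rewrite big_ord_recr EFinD; exact: integrableD.
under eq_Rintegral do rewrite big_ord_recr /=.
by rewrite RintegralD // RintegralZl // -eX -eN big_ord_recr.
Qed.

(** If the integral of the square against [f] were zero, [f] would vanish almost everywhere off the
    finite root set of [p]. The size bound keeps the square within the available moments. *)
Lemma moment_functional_sqr_gt0 M (u : 'rV[R]_M.+1) (p : {poly R}) :
  realizable u ->
  p != 0 -> ((size p).*2 <= M.+2)%N -> 0 < moment_functional u (p * p).
Proof.
move=> [f [mf f0 fn0 hf]] p0 pM.
have sz : (size (p * p)%R <= M.+1)%N.
  by rewrite size_mul // addnn; case: (_.*2) pM.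
have [ip ->] := moment_functional_integral hf sz.
have pos c : 0 <= (p * p).[c] * f c.
  by rewrite mulr_ge0 // hornerM -expr2 sqr_ge0.
rewrite lt_neqAle Rintegral_ge0 // andbT; apply/negP => /eqP int0.
apply: fn0.
have /integrableP[mpf _] := ip.
have : ae_eq mu setT (fun c => ((p * p).[c] * f c)%:E) (cst 0%E).
  apply/ae_eq_integral_abs => //.
  under eq_integral do rewrite gee0_abs ?lee_fin //.
  rewrite -[LHS]fineK; last exact: integrable_fin_num.
  by congr EFin; rewrite int0.
move: (ae_not_root p0); apply: filterS2.
  exact: (ae_filter_ringOfSetsType mu).
move=> c pc /(_ Logic.I) [].
by move=> /eqP; rewrite mulf_eq0 hornerM mulf_eq0 (negbTE pc) => /eqP.
Qed.

End Realizability.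

(** * The characteristic polynomial of the extended closure *)

Section Hyperbolicity.
Variables (R : realType) (M : nat) (u : 'rV[R]_M.+1).
Local Notation Q k := (residual u k k).

(** Equating the two expressions for [residual u k.+1 k.+2] gives a three-term recurrence for the
    [Q k] with positive last coefficient; it starts from 1 and a monic linear polynomial. *)
Lemma interlacing_pair_residual n k :
  (forall p : {poly R}, p != 0 -> (size p <= n.+1)%N ->
    0 < moment_functional u (p * p)) ->
  (k < n)%N -> interlacing_pair (Q k.+1) (Q k).
Proof.
move=> pos; elim: k => [|k IH] kn; last first.
  have := residual_succ pos kn; rewrite (residual_recurrence pos (ltnW kn)).
  move=> /esym/(canRL (addrK _)) ->.
  set b := sigma_diag u k.+1 / _.
  have b0 : 0 < b by rewrite divr_gt0 // (sigma_diag_gt0 pos) //; lia.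
  set a := alpha_sum u k; set a' := alpha_sum u k.+1.
  have -> : ('X + a%:P) * Q k.+1 - b *: Q k - a' *: Q k.+1 =
      ('X - (a' - a)%:P) * Q k.+1 - b *: Q k.
    by rewrite polyCB -!mul_polyC; ring.
  exact/interlacing_pair_step/IH/ltnW.
have -> : Q 0 = 1.
  by rewrite /residual (size_poly_leq0P _ (size_projXn u 0 0)) subr0.
have [c ec] : exists c, projXn u 1 1 = c%:P.
  by exists (projXn u 1 1)`_0; apply: size1_polyC; exact: size_projXn.
rewrite /residual ec expr1; split.
- exact: monicXsubC.
- by exists [:: c]; rewrite size_XsubC /= root_XsubC eqxx.
- by rewrite size_XsubC size_poly1.
- move=> x; rewrite derivXsubC -[1 in X in _ - X]/(1%:P) derivC.
  by rewrite !hornerE subr0.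
Qed.

(** The leading terms cancel, which matters because [a + b] may exceed [M]. *)
Lemma size_gramian_form_gradient k a b : (k <= a)%N ->
  (a + k <= M.+1)%N -> (b + k <= M.+1)%N ->
  (size ('X^(a + b) - residual u k a * residual u k b)%R <= M.+1)%N.
Proof.
move=> ka akM bkM.
have -> : 'X^(a + b) - residual u k a * residual u k b =
    residual u k a * projXn u k b + projXn u k a * 'X^b.
  by rewrite /residual exprD; ring.
have := size_projXn u k b; have := size_projXn u k a => sa sb.
rewrite (leq_trans (size_polyD _ _)) // geq_max.
apply/andP; split; rewrite (leq_trans (size_polyMleq _ _)) //.
  by rewrite size_residual // addSn (leq_trans _ akM) //= leq_add2l.
by rewrite size_polyXn addnS (leq_trans _ bkM) //= addnC leq_add2l.
Qed.

Lemma is_derive_sigma_diag (j : 'I_M.+1) k : gramian u k \in unitmx ->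
  (k.*2 <= M)%N ->
  is_derive u (delta_mx 0 j : 'rV[R]_M.+1) (fun v => sigma_diag v k)
    (Q k * Q k)`_j.
Proof.
move=> ku kM.
have := is_deriveB (is_derive_moment u j kM)
  (@is_derive_gramian_form _ _ u j k k k ku _ _ _).
rewrite addnn -coefB subKr; apply; lia.
Qed.

Lemma is_derive_sigma_next (j : 'I_M.+1) k : gramian u k \in unitmx ->
  (k.*2 < M)%N ->
  is_derive u (delta_mx 0 j : 'rV[R]_M.+1) (fun v => sigma_next v k)
    (residual u k k.+1 * Q k)`_j.
Proof.
move=> ku kM.
have := is_deriveB (is_derive_moment u j kM)
  (@is_derive_gramian_form _ _ u j k k.+1 k ku _ _ _).
rewrite addSn addnn -coefB subKr; apply; lia.
Qed.

(** Here [n.+1] stands for half of [M], avoiding predecessors. The [chi] part is the product and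
    quotient rule with the derivatives of the sigmas inserted. *)
Definition extended_closure_gradient (chi : R) n : {poly R} :=
  'X^(n.+2 + n.+1) - residual u n.+1 n.+2 * Q n.+1
  + chi *: (alpha_sum u n *: (Q n.+1 * Q n.+1
              - (sigma_diag u n.+1 / sigma_diag u n) *: (Q n * Q n))
            + (sigma_diag u n.+1 / sigma_diag u n) *:
              (residual u n n.+1 * Q n)).

Lemma is_derive_extended_gramian_closure (chi : R) (j : 'I_M.+1) n :
  M = n.+1.*2 -> (forall k, (k <= n.+1)%N -> gramian u k \in unitmx) ->
  sigma_diag u n != 0 ->
  is_derive u (delta_mx 0 j : 'rV[R]_M.+1) (extended_gramian_closure chi)
    (extended_closure_gradient chi n)`_j.
Proof.
move=> Mn gu sd0; set e := delta_mx 0 j.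
have dF : is_derive u e (fun v => gramian_form v n.+1 n.+2 n.+1)
    ('X^(n.+2 + n.+1) - residual u n.+1 n.+2 * Q n.+1)`_j.
  by apply: is_derive_gramian_form; [exact: gu|lia..].
have dD : is_derive u e (fun v => sigma_diag v n.+1) (Q n.+1 * Q n.+1)`_j.
  by apply: is_derive_sigma_diag; [exact: gu|lia].
have dD' : is_derive u e (fun v => sigma_diag v n) (Q n * Q n)`_j.
  by apply: is_derive_sigma_diag; [exact: gu|lia].
have dN : is_derive u e (fun v => sigma_next v n) (residual u n n.+1 * Q n)`_j.
  by apply: is_derive_sigma_next; [exact: gu|lia].
have dV : is_derive u e (fun v => (sigma_diag v n)^-1)
    (- (sigma_diag u n) ^- 2 *: (Q n * Q n)`_j).
  apply: DeriveDef; first by apply: derivableV => //; exact: ex_derive.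
  by rewrite deriveV // derive_val.
have -> : extended_gramian_closure chi =
    (fun v : 'rV[R]_M.+1 => gramian_form v n.+1 n.+2 n.+1) +
    (chi \*: ((fun v => sigma_diag v n.+1) * (fun v => (sigma_diag v n)^-1)) *
       (fun v => sigma_next v n)).
  apply/funext => v; rewrite /extended_gramian_closure.
  by rewrite (_ : M./2 = n.+1) //; lia.
apply: (@is_derive_eq).
rewrite /extended_closure_gradient /alpha_sum !(coefD, coefZ, coefN) /=.
have scaleE (x y : R) : x *: y = x * y by [].
rewrite !fctE !scaleE; congr (_ + _).

by field.
Qed.

(** The sum over [j] up to [M] recovers the whole gradient because the gradient has degree at most
    [M]. *)
Lemma closure_char_polyE (chi : R) n :
  M = n.+1.*2 ->
  (forall j : 'I_M.+1, 'D_(delta_mx 0 j) (extended_gramian_closure chi) u =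
    (extended_closure_gradient chi n)`_j) ->
  closure_char_poly (extended_gramian_closure chi) u =
    'X^(n.+2 + n.+1) - extended_closure_gradient chi n.
Proof.
move=> Mn eD; rewrite /closure_char_poly.
under eq_bigr do rewrite eD.
rewrite Mn; congr ('X^ _ - _); first lia.
rewrite -Mn -(poly_def M.+1 (fun j => (extended_closure_gradient chi n)`_j)).
apply/polyP => i; rewrite coef_poly; case: ltnP => // iM.
rewrite nth_default // (leq_trans _ iM) //.
have szM (p q : {poly R}) : (size p + size q <= M.+2)%N ->
    (size (p * q)%R <= M.+1)%N.
  by move=> pq; rewrite (leq_trans (size_polyMleq _ _)) //; case: (_ + _)%N pq.
have szD (p q : {poly R}) : (size p <= M.+1)%N -> (size q <= M.+1)%N ->
    (size (p + q)%R <= M.+1)%N.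
  by move=> sp sq; rewrite (leq_trans (size_polyD _ _)) // geq_max sp.
have szZ c (p : {poly R}) : (size p <= M.+1)%N -> (size (c *: p)%R <= M.+1)%N.
  by move=> sp; rewrite (leq_trans (size_scale_leq _ _)).
rewrite /extended_closure_gradient; apply: (szD).
  by apply: size_gramian_form_gradient; lia.
apply: (szZ); apply: (szD); apply: (szZ).
  apply: (szD); first by apply: szM; rewrite !size_residual; lia.
  by rewrite size_polyN; apply: (szZ); apply: szM; rewrite !size_residual; lia.
by apply: szM; rewrite !size_residual; lia.
Qed.

End Hyperbolicity.

Theorem corollary6p1 (R : realType) (M : nat) (hM : ~~ odd M)
    (hM2 : (2 <= M)%N) (chi : R) (hchi : -1 < chi) :
  strictly_hyperbolic (extended_gramian_closure (M := M) chi).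
Proof.
move=> u ru.
have [n Mn] : exists n, M = n.+1.*2.
  by exists M./2.-1; move: hM hM2; lia.
have pos (p : {poly R}) : p != 0 -> (size p <= n.+2)%N ->
    0 < moment_functional u (p * p).
  by move=> p0 sp; apply: moment_functional_sqr_gt0 => //; lia.
have sd0 := sigma_diag_gt0 pos (leqnSn n).
have sd1 := sigma_diag_gt0 pos (leqnn n.+1).
have gu k : (k <= n.+1)%N -> gramian u k \in unitmx.
  by move=> kn; apply: (gramian_unit pos); exact: leqW.
have dC j := is_derive_extended_gramian_closure chi j Mn gu (lt0r_neq0 sd0).
split; first by move=> j; exact: ex_derive.
rewrite (closure_char_polyE Mn (fun j => @derive_val _ _ _ _ _ _ _ (dC j))).
have := interlacing_pair_residual pos (ltnSn n).
set Q := residual u n.+1 n.+1; set Q' := residual u n n => QQ'.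
set a := alpha_sum u n; set beta := sigma_diag u n.+1 / sigma_diag u n.
have b0 : 0 < (1 + chi) * beta by rewrite mulr_gt0 ?divr_gt0 // -ltrBlDl sub0r.
(* Once both residuals are expanded, the [Q' * Q'] terms of the [chi] part cancel, leaving [Q] as a
   common factor. *)
have -> : 'X^(n.+2 + n.+1) - extended_closure_gradient u chi n =
    Q * (('X - ((chi - 1) * a)%:P) * Q - ((1 + chi) * beta) *: Q').
  rewrite /extended_closure_gradient (residual_recurrence pos (ltnSn n)).
  rewrite (residual_succ pos (ltnSn n)) -/Q -/Q' -/a -/beta.
  rewrite -!mul_polyC !(polyCB, polyCM, polyCD) polyC1.
  ring.
have [rm [t [ut st rt]] _ Wr] := interlacing_pair_step ((chi - 1) * a) b0 QQ'.
have [Qm [s [us ss rs]] _ _] := QQ'.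
set r := _ - _ in rm st rt Wr *.
have sQ : size Q = n.+2 by rewrite size_residual.
have sr : size r = n.+3.
  rewrite size_three_term ?sQ // size_residual //.
exists (s ++ t); split.
(* At a common root of [Q] and [r] their Wronskian would vanish, contradicting [Wr]. *)
- rewrite cat_uniq us ut andbT /=; apply/hasPn => x xt; apply/negP => xs.
  have := Wr x; have /rootP -> := allP rs _ xs; have /rootP -> := allP rt _ xt.
  by rewrite mulr0 mul0r subrr ltxx.
- by rewrite size_cat ss st sQ sr /= Mn; lia.
- rewrite all_cat; apply/andP; split; apply/allP => x.
    by move=> /(allP rs); rewrite rootM => ->.
  by move=> /(allP rt); rewrite rootM => ->; rewrite orbT.
Qed.
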